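(* Let $\lambda\vdash n$ with $\lambda'=(s,r)$, $s\ge r\ge1$. Then: (i) If $\pi$ is a minimal permutation of shape $\lambda$ and $J_1\neq J_2$ are jump partitions for $\pi$, each of size less than $r$ and each valid for $\pi$, then $J_1(\pi)\neq J_2(\pi)$. (ii) If $\pi_1\neq\pi_2$ are minimal permutations of shape $\lambda$, and $J_1$ (resp. $J_2$) is a jump partition of size less than $r$ valid for $\pi_1$ (resp. $\pi_2$), then $J_1(\pi_1)\neq J_2(\pi_2)$.
   Context: Shape means Robinson–Schensted shape; $\lambda'$ is the conjugate of $\lambda$. A minimal permutation of shape $\lambda$ is a permutation of shape $\lambda$ with the fewest inversions; for $\lambda'=(s,r)$ these are exactly $(c_1,c_1-1,\dots,1,\,n,\dots,c_1+1)$ (one-line notation) with $(c_1,c_2)\in\{(s,r),(r,s)\}$, $n=s+r$. For such $\pi$: $s_t$ is the adjacent transposition $(t\ t{+}1)$; $\sigma\cdot s_t$ swaps the entries at positions $t,t+1$ of $\sigma$, and $s_t\cdot\sigma$ swaps the values $t,t+1$; products act successively (left to right for right multiplication, rightmost first for left multiplication). An inner (resp. outer) jump partition is an integer partition $\mu$ (resp. $\nu$), possibly empty, with $\ell(\mu)\le c_1$, $\mu_1<c_2$ (resp. $\ell(\nu)\le c_1$, $\nu_1<c_2$). Actions: $\pi\circ\mu=\pi\cdot\prod_{j=1}^{\ell(\mu)}(s_{c_1-j+1}s_{c_1-j+2}\cdots s_{c_1-j+\mu_j})$ (factors in order $j=1,2,\dots$ left to right), and $\nu\circ\pi=F_{\ell(\nu)}\cdots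 F_1\cdot\pi$ with $F_j=s_{c_1-j+\nu_j}\cdots s_{c_1-j+2}s_{c_1-j+1}$. A jump partition is a pair $J=(\mu,\nu)$ of size $|\mu|+|\nu|$, with $J(\pi)=\nu\circ(\pi\circ\mu)$; it is valid for $\pi$ if the shape of $J(\pi)$ equals the shape of $\pi$. *)

(* Defs.v *)
From mathcomp Require Import all_boot all_order all_fingroup.

Set Implicit Arguments.
Unset Strict Implicit.
Unset Printing Implicit Defensive.

(* Integer partitions: weakly decreasing lists of positive parts. *)
Definition is_part (la : seq nat) : bool := sorted geq la && (0 \notin la).

Definition part_of (n : nat) (la : seq nat) : bool :=
  is_part la && (sumn la == n).

Definition conj_part (la : seq nat) : seq nat :=
  [seq count (fun p => i < p) la | i <- iota 0 (head 0 la)].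

(* Schensted row insertion; the second component is the bumped entry. *)
Fixpoint row_insert (x : nat) (row : seq nat) : seq nat * option nat :=
  if row is y :: row' then
    if x < y then (x :: row', Some y)
    else let: (row'', b) := row_insert x row' in (y :: row'', b)
  else ([:: x], None).

Fixpoint tab_insert (x : nat) (t : seq (seq nat)) : seq (seq nat) :=
  if t is row :: t' then
    let: (row', b) := row_insert x row in
    if b is Some y then row' :: tab_insert y t' else row' :: t'
  else [:: [:: x]].

Definition P_tableau (w : seq nat) : seq (seq nat) :=
  foldl (fun t x => tab_insert x t) [::] w.

(* One-line notation, with values in {1, ..., n}. *)
Definition one_line (n : nat) (p : 'S_n) : seq nat :=
  [seq (p i : nat).+1 | i <- enum 'I_n].

Definition RS_shape (n : nat) (p : 'S_n) : seq nat :=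
  [seq size row | row <- P_tableau (one_line p)].

Definition inversions (n : nat) (p : 'S_n) : nat :=
  #|[set ij : 'I_n * 'I_n | (ij.1 < ij.2) && (p ij.2 < p ij.1)]|.

Definition minimal_perm (n : nat) (la : seq nat) (p : 'S_n) : Prop :=
  RS_shape p = la /\
  forall q : 'S_n, RS_shape q = la -> inversions p <= inversions q.

(* The transposition (t t+1) of {1, ..., n}, for 1 <= t < n; since 'I_n is
   {0, ..., n-1}, it exchanges the ordinals t-1 and t.  It is the identity,
   by convention, for t out of range. *)
Definition adj_tr (n t : nat) : 'S_n :=
  if t is t'.+1 then
    match insub t' : option 'I_n, insub t : option 'I_n with
    | Some i, Some j => tperm i j
    | _, _ => 1%g
    end
  else 1%g.

(* MathComp's product of permutations is (p * q) i = q (p i), the reverse of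
   composition of functions: multiplying on the right by s_t in the usual
   notation (exchanging the entries at positions t, t+1) is adj_tr n t * p,
   and multiplying on the left (exchanging the values t, t+1) is
   p * adj_tr n t. *)
Definition swap_positions (n : nat) (p : 'S_n) (t : nat) : 'S_n :=
  (adj_tr n t * p)%g.

Definition swap_values (n : nat) (p : 'S_n) (t : nat) : 'S_n :=
  (p * adj_tr n t)%g.

(* For a permutation (c1, ..., 1, n, ..., c1+1), with c1, c2 >= 1 and
   n = c1 + c2, the integer c1 is the first entry of its one-line notation. *)
Definition col1 (n : nat) (p : 'S_n) : nat := head 0 (one_line p).
Definition col2 (n : nat) (p : 'S_n) : nat := n - col1 p.

(* The indices c-j+1, c-j+2, ..., c-j+mu_j, for j = 1, ..., l(mu) in turn, in
   the order in which the transpositions are applied.  The order is the same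
   for both actions, as left products act rightmost factor first. *)
Definition jump_word (c : nat) (mu : seq nat) : seq nat :=
  flatten [seq [seq c - j + m | m <- iota 1 (nth 0 mu j.-1)]
          | j <- iota 1 (size mu)].

Definition inner_act (n c : nat) (p : 'S_n) (mu : seq nat) : 'S_n :=
  foldl (@swap_positions n) p (jump_word c mu).

Definition outer_act (n c : nat) (nu : seq nat) (p : 'S_n) : 'S_n :=
  foldl (@swap_values n) p (jump_word c nu).

(* Inner and outer jump partitions satisfy the same bounds. *)
Definition is_jump_component (n : nat) (p : 'S_n) (mu : seq nat) : bool :=
  [&& is_part mu, size mu <= col1 p & head 0 mu < col2 p].

(* A jump partition is a pair J = (mu, nu), with mu inner and nu outer. *)
Definition is_jump (n : nat) (p : 'S_n) (J : seq nat * seq nat) : bool :=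
  is_jump_component p J.1 && is_jump_component p J.2.

Definition jump_size (J : seq nat * seq nat) : nat := sumn J.1 + sumn J.2.

(* Both actions use the parameter c1 of the original permutation p, not that
   of the intermediate permutation. *)
Definition jump_act (n : nat) (J : seq nat * seq nat) (p : 'S_n) : 'S_n :=
  outer_act (col1 p) J.2 (inner_act (col1 p) p J.1).

Definition valid_jump (n : nat) (p : 'S_n) (J : seq nat * seq nat) : Prop :=
  RS_shape (jump_act J p) = RS_shape p.

(* Main.v *)
Require Import Defs.
From mathcomp Require Import all_boot all_order all_fingroup.
From mathcomp Require Import zify.

(* By Schensted's theorem, the non-inversions of a permutation of shape
   [lambda], [lambda' = (s, r)], form a graph without chains of length 3 whose
   largest independent set D has size s.  Each of the r points outside D has an
   independent neighbourhood, so there are at most s r non-inversions; in the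
   case of equality, i.e. for a minimal permutation, the graph is complete
   bipartite between D and its complement, and this forces the layered form
   (c, ..., 1, n, ..., c+1).

   J(p) is again a union of two decreasing sequences, carried by a set A of c
   positions and its complement, and A does not contain the last position z.  At
   most |J| < r <= c pairs of A x ~A are inversions of J(p).  If
   J1(p1) = J2(p2) and x lies in A2 but not in A1, then each of the c1 points of
   A1 forms an inversion with x (if it is in A2) or with z (if not), which is too
   many.  Hence A1 = A2, so that c1 = c2 and p1 = p2.  The set A determines the
   inner partition, and then the values of J(p) on A determine the outer one. *)

Set Implicit Arguments.
Unset Strict Implicit.
Unset Printing Implicit Defensive.

(** * Decreasing and increasing subsequences under row insertion *)

Definition has_dec (k : nat) (w : seq nat) : Prop :=
  exists t, [/\ subseq t w, pairwise gtn t & size t = k].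

Lemma subseq_cat_split (T : eqType) (t u v : seq T) :
  subseq t (u ++ v) ->
  exists t1 t2, [/\ t = t1 ++ t2, subseq t1 u & subseq t2 v].
Proof.
move=> /subseqP [m sz_m ->].
exists (mask (take (size u) m) u), (mask (drop (size u) m) v).
split; try exact: mask_subseq.
rewrite -mask_cat ?cat_take_drop // size_take sz_m size_cat.
by case: ltnP => //; lia.
Qed.

Lemma subseq_seq1 (T : eqType) (t : seq T) (x : T) :
  subseq t [:: x] -> t = [::] \/ t = [:: x].
Proof.
move=> sub; have := size_subseq sub.
case: t sub => [|y [|z t]] //; first by left.
by rewrite sub1seq inE => /eqP ->; right.
Qed.

Lemma subseq_rcons_split (T : eqType) (t w : seq T) (x : T) :
  subseq t (rcons w x) ->
  subseq t w \/ exists2 t', t = rcons t' x & subseq t' w.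
Proof.
rewrite -cats1 => /subseq_cat_split [t1 [t2 [-> t1w /subseq_seq1[]->]]].
  by rewrite cats0; left.
by right; exists t1; rewrite ?cats1.
Qed.

(** The pieces of a decreasing subsequence in [u] and [v] see the middle piece only through its
    strict upper and lower bounds, so a replacement of the same length that keeps these bounds fits
    between them. *)
Lemma has_dec_mid k u v m m' :
  (forall t, subseq t m -> pairwise gtn t ->
     exists t', [/\ subseq t' m', pairwise gtn t', size t' = size t,
       forall z, all (gtn z) t -> all (gtn z) t'
     & forall z, all (ltn z) t -> all (ltn z) t']) ->
  has_dec k (u ++ m ++ v) -> has_dec k (u ++ m' ++ v).
Proof.
move=> mm' [t [/subseq_cat_split[t1 [t' [-> t1u]]]]].
move=> /subseq_cat_split[t2 [t3 [-> t2m t3v]]].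
rewrite !pairwise_cat allrel_catr.
case/and5P=> /andP[r12 r13] p1 r23 p2 p3 <-.
have [t2' [sub2 p2' sz2 up lo]] := mm' _ t2m p2.
exists (t1 ++ t2' ++ t3); split.
- by rewrite !cat_subseq.
- rewrite !pairwise_cat allrel_catr r13 p1 p2' p3 !andbT /=.
  apply/andP; split.
  + by apply/allP => z zt1; apply: up; exact: (allP r12).
  + rewrite allrelC; apply/allP => z zt3; apply: lo.
    by rewrite allrelC in r23; exact: (allP r23).
- by rewrite !size_cat sz2.
Qed.

Lemma dec_in_row t row :
  sorted leq row -> subseq t row -> pairwise gtn t -> 
  t = [::] \/ exists2 e, t = [:: e] & e \in row.
Proof.
move=> srow sub; have := subseq_sorted leq_trans sub srow.
case: t sub => [|e [|f t]] sub /=; first by left.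
- by right; exists e; rewrite -?sub1seq.
- by case/andP=> ef _ /andP[/andP[fe _] _]; move: ef fe => /=; lia.
Qed.

(* Inserting [x] into the row [a ++ y :: b] bumps [y]; the two words below are
   Knuth equivalent.  A decreasing subsequence meets a row at most once, so a
   pair of letters taken from the middle block can be replaced by [y; x]. *)
Lemma has_dec_bump k u v a b x y :
  sorted leq (a ++ y :: b) -> sorted leq (a ++ x :: b) ->
  all (geq x) a -> x < y -> all (leq y) b ->
  has_dec k (u ++ ((a ++ y :: b) ++ [:: x]) ++ v) <->
  has_dec k (u ++ (y :: a ++ x :: b) ++ v).
Proof.
move=> s1 s2 /allP ax xy /allP yb; split; apply: has_dec_mid => t.
- move=> /subseq_cat_split[ta [tx [-> /(dec_in_row s1) Ha /subseq_seq1 Hx]]].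
  rewrite pairwise_cat => /and3P[r pa _]; case: {Ha}(Ha pa) => [ea|[e ea ein]];
    case: Hx => ex; subst ta tx.
  + by exists [::].
  + exists [:: x]; split=> //; rewrite sub1seq !inE mem_cat mem_head.
    by rewrite !orbT.
  + exists [:: e]; split=> //; rewrite sub1seq.
    by move: ein; rewrite !(inE, mem_cat); case/or3P => ->; rewrite ?orbT.
  + exists [:: y; x]; split=> //=; rewrite ?eqxx ?xy //.
    * by rewrite sub1seq mem_cat mem_head orbT.
    * have ye : y <= e.
        move: r ein; rewrite /allrel /= !(inE, mem_cat) !andbT => xe.
        case/or3P=> [/ax|/eqP->|/yb] //=; move: xe => /=; lia.
      by move=> z /=; lia.
    * by move=> z /=; lia.
- move=> /(@subseq_cat_split _ _ [:: y])[ty [ta [-> /subseq_seq1 Hy /(dec_in_row s2) Ha]]].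
  rewrite pairwise_cat => /and3P[r _ pa]; case: {Ha}(Ha pa) => [ea|[e ea ein]];
    case: Hy => ey; subst ta ty.
  + by exists [::]; rewrite sub0seq.
  + exists [:: y]; split=> //; rewrite sub1seq !(inE, mem_cat).
    by rewrite eqxx !orbT.
  + exists [:: e]; split=> //; rewrite sub1seq.
    by move: ein; rewrite !(inE, mem_cat); case/or3P => ->; rewrite ?orbT.
  + exists [:: y; x]; split=> //=; rewrite ?xy //.
    * apply: (@cat_subseq _ [:: y] [:: x]); rewrite ?sub1seq ?mem_head //.
      by rewrite mem_cat mem_head orbT.
    * by move=> z /=; lia.
    (* As [e < y], the letter [e] is not in [b], so it is [x] or lies in [a]; lower bounds of [e]
       then bound [x]. *)
    * have ex : e <= x.
        move: r ein; rewrite /allrel /= !(inE, mem_cat) !andbT => xe.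
        case/or3P=> [/ax|/eqP->|/yb] //=; move: xe => /=; lia.
      by move=> z /=; lia.
Qed.

Lemma row_insertP x row : sorted leq row ->
  match (row_insert x row).2 with
  | None => (row_insert x row).1 = rcons row x
  | Some y => exists a b, [/\ row = a ++ y :: b,
      (row_insert x row).1 = a ++ x :: b,
      all (geq x) a, x < y & all (leq y) b]
  end /\ sorted leq (row_insert x row).1.
Proof.
elim: row => [|h row IH] //= hrow; have srow := path_sorted hrow.
case: ltnP => [xh|hx] /=.
  split; first by exists [::], row; split=> //; apply: order_path_min hrow => //; exact: leq_trans.
  by case: row hrow {IH srow} => //= h' row /andP[hh' ->]; rewrite andbT; lia.
case: (IH srow); case: (row_insert x row) => row' [y|] /=.
- case=> a [b [er -> ax xy yb]] s'; subst row; split.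
    by exists (h :: a), b; split=> //=; rewrite hx.
  case: a hrow s' {IH srow ax} => [|h' a] /= /andP[hh' _] ->; rewrite andbT //; lia.
- move=> -> s'; split=> //.
  by case: row hrow s' {IH srow} => [|h' a] /=; rewrite ?hx // => /andP[-> _] ->.
Qed.

(** The lowest row comes first, so that an entry bumped out of a row stands just before that row, as
    in [has_dec_bump]. *)
Definition row_reading (T : seq (seq nat)) : seq nat := flatten (rev T).

Lemma row_reading_cons row T : row_reading (row :: T) = row_reading T ++ row.
Proof. by rewrite /row_reading rev_cons flatten_rcons. Qed.

(** A weakening of being a tableau: columns are constrained through the first one only, and [z]
    stands for the head of the row above, with 0 at the top. *)
Definition tableau_like (z : nat) (T : seq (seq nat)) : bool :=
  [&& all (sorted leq) T, [::] \notin T & path ltn z [seq head 0 row | row <- T]].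

Lemma tableau_like_lower z z' T : z' <= z -> tableau_like z T -> tableau_like z' T.
Proof.
rewrite /tableau_like => zz' /and3P[-> -> /=].
by case: T => //= row T /andP[zh ->]; rewrite andbT; lia.
Qed.

Lemma tableau_like_cons z row T :
  tableau_like z (row :: T) =
  [&& sorted leq row, row != [::], z < head 0 row & tableau_like (head 0 row) T].
Proof.
rewrite /tableau_like /= inE negb_or eq_sym.
by case: sorted; case: eqP; case: all; case: (_ \in _); rewrite ?andbF.
Qed.

(** Either [x] replaces the head [h > x], which goes down, or the head stays and a bumped entry
    exceeds [x >= h]: any entry passed on exceeds the new head. *)
Lemma tab_insert_like z x T :
  z < x -> tableau_like z T -> tableau_like z (tab_insert x T).
Proof.
elim: T z x => [|row T IH] z x zx; first by rewrite /tableau_like /= zx.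
rewrite tableau_like_cons => /and4P[srow]; case: row srow => // h row srow _ /= zh hT.
have [] := row_insertP x srow; rewrite /=; case: ltnP => [xh|hx] /=.
  move=> _ s'; rewrite tableau_like_cons /= s' zx IH //.
  by apply: tableau_like_lower hT; exact: ltnW.
case E: (row_insert x row) => [row' [y|]] /=; rewrite tableau_like_cons /= zh.
  case=> a [b [_ _ _ xy _]] ->; rewrite IH //; lia.
by move=> _ ->.
Qed.

(** The suffix [v] carries the induction: after a bump, the modified row joins the suffix while the
    bumped entry is inserted below. *)
Lemma has_dec_tab_insert k x T v :
  all (sorted leq) T ->
  has_dec k (row_reading T ++ x :: v) <->
  has_dec k (row_reading (tab_insert x T) ++ v).
Proof.
elim: T x v => [|row T IH] x v //= /andP[srow sT].
have [] := row_insertP x srow.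
case E: (row_insert x row) => [row' [y|]] /=.
- case=> a [b [er er' ax xy yb]] s'; subst row row'.
  rewrite !row_reading_cons -(catA _ _ v) -IH // -!(catA (row_reading T)).
  have := has_dec_bump k (row_reading T) v srow s' ax xy yb.
  by rewrite -!catA /= -!catA.
- by move=> -> _; rewrite !row_reading_cons -cats1 -!catA.
Qed.

Lemma has_dec_foldl k w T : all (leq 1) w -> tableau_like 0 T ->
  let T' := foldl (fun t x => tab_insert x t) T w in
  tableau_like 0 T' /\ (has_dec k (row_reading T ++ w) <-> has_dec k (row_reading T')).
Proof.
elim: w T => [|x w IH] T /=; first by rewrite cats0.
case/andP=> x0 w0 T0.
have [-> <-] := IH _ w0 (tab_insert_like x0 T0).
by split=> //; apply: has_dec_tab_insert; case/and3P: T0.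
Qed.

(** By [dec_in_row], each row contributes at most one letter. *)
Lemma has_dec_reading_le k T : all (sorted leq) T ->
  has_dec k (row_reading T) -> k <= size T.
Proof.
elim: T k => [|row T IH] k /=.
  by move=> _ [t [+ _ <-]]; move=> /eqP ->.
case/andP=> srow sT [t []]; rewrite row_reading_cons.
move=> /subseq_cat_split[t1 [t2 [-> sub1 sub2]]].
rewrite pairwise_cat => /and3P[_ p1 p2] <-; rewrite size_cat.
have : size t1 <= size T by apply: IH => //; exists t1.
by case: (dec_in_row srow sub2 p2) => [->|[e -> _]] /=; lia.
Qed.

(** The witness is the first column, read upwards. *)
Lemma has_dec_reading_size z T : tableau_like z T -> has_dec (size T) (row_reading T).
Proof.
case/and3P=> _ ne /path_sorted sh.
exists (rev [seq head 0 row | row <- T]); split.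
- elim: T ne {sh} => [|row T IH] //=; rewrite inE negb_or => /andP[ne /IH sub].
  rewrite rev_cons row_reading_cons -cats1 cat_subseq // sub1seq.
  by case: row ne => //= a row _; rewrite mem_head.
- by rewrite -sorted_pairwise ?rev_sorted //; move=> b a c /= ba cb; exact: ltn_trans cb ba.
- by rewrite size_rev size_map.
Qed.

(** Schensted's theorem for decreasing subsequences: insertion preserves their possible lengths,
    which are visible on the reading word of the tableau. *)
Lemma has_dec_rows w : all (leq 1) w ->
  has_dec (size (P_tableau w)) w /\
  forall k, has_dec k w -> k <= size (P_tableau w).
Proof.
move=> w0; split=> [|k].
  have [T0 /= ->] := @has_dec_foldl (size (P_tableau w)) w [::] w0 isT.
  exact: has_dec_reading_size T0.
have [/and3P[sT _ _] /= ->] := @has_dec_foldl k w [::] w0 isT.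
exact: has_dec_reading_le.
Qed.

(** * Increasing subsequences and the first row *)

Lemma row_insert_le x row (row' := (row_insert x row).1) :
  size row <= size row' /\ forall i, i < size row -> nth 0 row' i <= nth 0 row i.
Proof.
rewrite {}/row'; elim: row => [|h row [sz IH]] //=; case: (ltnP x h) => xh /=.
  by split=> // -[|i] //= _; exact: ltnW.
case: (row_insert x row) sz IH => row' b /= sz IH; split=> // -[|i] //=; exact: IH.
Qed.

Lemma row_insert_new x row k (row' := (row_insert x row).1) :
  k <= size row -> (forall i, i < k -> nth 0 row i <= x) ->
  k < size row' /\ nth 0 row' k <= x.
Proof.
rewrite {}/row'; elim: row k => [|h row IH] [|k] //= ks le_x.
- by case: (ltnP x h) => //; case: row_insert.
- rewrite (ltnNge x h) (le_x 0) //=; case: row_insert (IH k ks (fun i => le_x i.+1)) => //.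
Qed.

(** One half of Schensted's theorem for increasing subsequences. *)
Lemma inc_le_first_row w t :
  subseq t w -> sorted leq t -> size t <= size (head [::] (P_tableau w)).
Proof.
(* The entrywise bound drives the induction: if the [k] letters before [x] bound the first [k]
   entries of the row, then [x] bumps none of these, and the entry of index [k] becomes at most
   [x]. *)
suff: subseq t w -> sorted leq t -> 
      size t <= size (head [::] (P_tableau w)) /\
      forall i, i < size t -> nth 0 (head [::] (P_tableau w)) i <= nth 0 t i.
  by move=> H /H{}H /H [].
elim/last_ind: w t => [|w x IH] t; first by rewrite subseq0 => /eqP ->.
rewrite /P_tableau foldl_rcons -/(P_tableau w).
have -> : head [::] (tab_insert x (P_tableau w)) =
          (row_insert x (head [::] (P_tableau w))).1.
  by case: P_tableau => //= row T; case: row_insert => row' [].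
set row := head _ _ in IH *; have [sz le] := row_insert_le x row.
case/subseq_rcons_split=> [/IH{}IH /IH [le_t H]|[t' -> /IH{}IH]].
  split=> [|i it]; first exact: leq_trans sz.
  by apply: leq_trans (le _ _) (H _ it); exact: leq_trans it le_t.
rewrite sorted_pairwise; last exact: leq_trans.
rewrite pairwise_rcons => /andP[/all_nthP t'x]; rewrite -sorted_pairwise; last exact: leq_trans.
case/IH=> le_t' H.
have [|] := @row_insert_new x row _ le_t' _.
  by move=> i it'; exact: leq_trans (H _ it') (t'x 0 _ it').
rewrite size_rcons => ltn leq_x; split=> // i; rewrite ltnS leq_eqVlt.
case/orP=> [/eqP ->|it']; first by rewrite nth_rcons ltnn eqxx.
rewrite nth_rcons it'; apply: leq_trans (le _ _) (H _ it'); exact: leq_trans it' le_t'.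
Qed.

(** * Decreasing sets of positions *)

Lemma enum_set_subseq (T : finType) (S : {set T}) : subseq (enum S) (enum T).
Proof. by rewrite enumT; exact: filter_subseq. Qed.

Lemma pairwise_enum_ord n (S : {set 'I_n}) :
  pairwise (fun i j : 'I_n => i < j) (enum S).
Proof.
have lt_tr : transitive (fun i j : 'I_n => i < j) by move=> j i k; exact: ltn_trans.
rewrite -sorted_pairwise // (subseq_sorted lt_tr (enum_set_subseq S)) //.
have := iota_ltn_sorted 0 n; rewrite -val_enum_ord.
by rewrite sorted_map.
Qed.

Lemma subword_of_set n (p : 'S_n) (e : rel nat) (S : {set 'I_n}) :
  (forall i j : 'I_n, i \in S -> j \in S -> i < j -> e (p i).+1 (p j).+1) ->
  exists t, [/\ subseq t (one_line p), pairwise e t & size t = #|S|].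
Proof.
move=> eS; exists [seq (p i : nat).+1 | i <- enum S]; split.
- by rewrite map_subseq ?enum_set_subseq.
- rewrite pairwise_map; have sub : all (mem S) (enum S) by apply/allP => i; rewrite mem_enum.
  apply: sub_in_pairwise sub (pairwise_enum_ord S) => i j iS jS; exact: eS.
- by rewrite size_map -cardE.
Qed.

Lemma pairwise_total (T : eqType) (e : rel T) (t : seq T) x y :
  pairwise e t -> x \in t -> y \in t -> [\/ x = y, e x y | e y x].
Proof.
elim: t => //= z t IH /andP[/allP ez /IH{}IH]; rewrite !inE.
case/predU1P=> [->|xt] /predU1P[->|yt].
- by constructor 1.
- by constructor 2; exact: ez.
- by constructor 3; exact: ez.
- exact: IH.
Qed.

Lemma set_of_subword n (p : 'S_n) (e : rel nat) (t : seq nat) :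
  subseq t (one_line p) -> pairwise e t ->
  exists2 S : {set 'I_n}, #|S| = size t &
    forall i j : 'I_n, i \in S -> j \in S -> i < j -> e (p i).+1 (p j).+1.
Proof.
move=> /subseqP[m sz_m ->]; rewrite -map_mask size_map pairwise_map.
set u := mask m _; have sub : subseq u (enum 'I_n) by exact: mask_subseq.
have uniq_u : uniq u by exact: subseq_uniq sub (enum_uniq _).
have lt_u : pairwise (fun i j : 'I_n => i < j) u.
  by apply: subseq_pairwise sub _; rewrite enumT -enum_setT pairwise_enum_ord.
move=> e_u; exists [set i in u]; first by rewrite cardsE; exact/card_uniqP.
(* The two relations are combined so that the order of the positions selects the orientation given
   by [pairwise_total]. *)
have both : pairwise (fun i j : 'I_n => (i < j) && e (p i).+1 (p j).+1) u.
  by have := pairwise_relI (fun i j : 'I_n => i < j) (relpre (fun i => (p i).+1) e) u; rewrite /= lt_u e_u.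
move=> i j; rewrite !inE => iu ju ij.
by case: (pairwise_total both iu ju) => [eij|/andP[]|/andP[]] //; move: ij; rewrite ?eij; lia.
Qed.

Definition dec_set n (p : 'S_n) (S : {set 'I_n}) : Prop :=
  forall i j : 'I_n, i \in S -> j \in S -> i < j -> p j < p i.

Lemma one_line_pos n (p : 'S_n) : all (leq 1) (one_line p).
Proof. by rewrite all_map; apply/allP. Qed.

Lemma dec_set_rows n (p : 'S_n) :
  (exists2 D : {set 'I_n}, #|D| = size (RS_shape p) & dec_set p D) /\
  forall D : {set 'I_n}, dec_set p D -> #|D| <= size (RS_shape p).
Proof.
rewrite size_map; have [[t [sub pt szt]] max] := has_dec_rows (one_line_pos p).
split=> [|D decD].
  by have [D cardD decD] := set_of_subword sub pt; exists D; rewrite ?cardD.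
apply: max; have [t' [sub' pt' szt']] := @subword_of_set n p gtn D decD.
by exists t'.
Qed.

Lemma inc_triple_row n (p : 'S_n) (i j k : 'I_n) :
  i < j < k -> p i < p j < p k -> 2 < head 0 (RS_shape p).
Proof.
move=> /andP[ij jk] /andP[pij pjk].
have -> : head 0 (RS_shape p) = size (head [::] (P_tableau (one_line p))).
  by rewrite /RS_shape; case: P_tableau.
have card3 : #|[set i; j; k]| = 3.
  by rewrite -setUA cardsU1 cards2 !inE -!(inj_eq val_inj) /=; lia.
have [|t [sub pt szt]] := @subword_of_set n p leq [set i; j; k].
  by move=> x y; rewrite !inE -!orbA => /or3P[]/eqP-> /or3P[]/eqP->; lia.
rewrite -card3 -szt; apply: inc_le_first_row => //.
by rewrite sorted_pairwise //; exact: leq_trans.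
Qed.

(** The 0-based form of [(c, ..., 1, n, ..., c+1)]: the intervals [[0, c)] and [[c, n)] are each
    reversed. *)
Definition layered n (c : nat) (p : 'S_n) : Prop :=
  forall i : 'I_n, (p i : nat) = if i < c then c.-1 - i else n.-1 + c - i.

Lemma layered_exists n c : c <= n -> exists p : 'S_n, layered c p.
Proof.
move=> cn; pose f (i : 'I_n) : 'I_n :=
  insubd i (if i < c then c.-1 - i else n.-1 + c - i).
have fE i : val (f i) = if i < c then c.-1 - i else n.-1 + c - i.
  rewrite val_insubd; have := ltn_ord i; case: (ltnP i c) => ic; case: ifP => //=; lia.
have fK : involutive f.
  move=> i; apply: val_inj; rewrite fE (fE i); have := ltn_ord i; case: (ltnP i c) => ic; case: ifP => /=; lia.
by exists (perm (inv_inj fK)) => i; rewrite permE; exact: fE.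
Qed.

Lemma layered_inj n c (p q : 'S_n) : layered c p -> layered c q -> p = q.
Proof. by move=> hp hq; apply/permP => i; apply: val_inj; rewrite /= hp hq. Qed.

(** * Minimal permutations of two-column shape are layered *)

Fixpoint two_columns (a b : seq nat) : seq (seq nat) :=
  match a, b with
  | [::], _ => [::]
  | x :: a', [::] => [:: x] :: two_columns a' [::]
  | x :: a', y :: b' => [:: x; y] :: two_columns a' b'
  end.

Lemma tab_insert_column1 x a : path ltn x a ->
  tab_insert x (two_columns a [::]) = two_columns (x :: a) [::].
Proof. by elim: a x => //= y a IH x /andP[-> /IH ->]. Qed.

(** The second column slides down by one row; the strict inequality of sizes provides a row for its
    last entry. *)
Lemma tab_insert_column2 x a b :
  size b < size a -> path ltn x b -> all (geq x) a ->
  tab_insert x (two_columns a b) = two_columns a (x :: b).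
Proof.
elim: a b x => [|y a IH] [|z b] x //=; rewrite ltnS => sz.
  by rewrite ltnNge => _ /andP[-> _].
move=> /andP[xz pz] /andP[yx ax]; rewrite ltnNge yx xz /= IH //.
by apply: sub_all ax => u /= ux; lia.
Qed.

(** Inserting a decreasing run pushes a column down: the first block builds the first column, and
    the second block, whose entries are larger, builds the second. *)
Lemma P_tableau_layered s r : r <= s ->
  P_tableau (rev (iota 1 s) ++ rev (iota s.+1 r)) =
  two_columns (iota 1 s) (iota s.+1 r).
Proof.
move=> rs; rewrite /P_tableau foldl_cat !foldl_rev.
have -> : foldr tab_insert [::] (iota 1 s) = two_columns (iota 1 s) [::].
  elim: s 1 {rs} => [|s IH] m //=; rewrite IH tab_insert_column1 //.
  by have := iota_ltn_sorted m s.+1.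
have : all (fun x => x < s.+1) (iota 1 s) by apply/allP => x; rewrite mem_iota; lia.
elim: r s.+1 rs => [|r IH] m //= rs lem; rewrite IH ?tab_insert_column2 ?size_iota ?(ltnW rs) //.
- by have := iota_ltn_sorted m r.+1.
- by apply: sub_all lem => u /= um; lia.
- by apply: sub_all lem => u /= um; lia.
Qed.

Lemma shape_two_columns a b : size b <= size a ->
  [seq size row | row <- two_columns a b] =
  nseq (size b) 2 ++ nseq (size a - size b) 1.
Proof.
elim: a b => [|x a IH] [|y b] //= sz; rewrite IH ?subn0 //=.
Qed.

(** This permutation is the competitor with which a minimal permutation is compared. *)
Lemma layered_shape s r (p : 'S_(s + r)) : r <= s -> layered s p ->
  RS_shape p = nseq r 2 ++ nseq (s - r) 1.
Proof.
move=> rs hp; rewrite /RS_shape.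
have -> : one_line p = rev (iota 1 s) ++ rev (iota s.+1 r).
  pose f i := (if i < s then s.-1 - i else (s + r).-1 + s - i).+1.
  have -> : one_line p = map f (iota 0 (s + r)).
    by rewrite -val_enum_ord -map_comp; apply: eq_map => i /=; rewrite hp.
  apply: (@eq_from_nth _ 0); first by rewrite size_map size_cat !size_rev !size_iota.
  move=> i; rewrite size_map size_iota => isr.
  rewrite (nth_map 0) ?size_iota // nth_iota // nth_cat size_rev size_iota /f add0n.
  case: ltnP => is_; rewrite nth_rev ?size_iota ?nth_iota; lia.
by rewrite P_tableau_layered // shape_two_columns !size_iota.
Qed.

Lemma two_column_shape la s r :
  is_part la -> conj_part la = [:: s; r] -> la = nseq r 2 ++ nseq (s - r) 1.
Proof.
move=> /andP[sla nla] conj; have := congr1 size conj.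
rewrite size_map size_iota /= => hla; move: conj; rewrite /conj_part hla /= => -[<- <-].
(* Now [s] and [r] have become the numbers of parts exceeding 0 and 1, and only the bound on the
   first part is kept for the induction. *)
have {hla}: head 0 la <= 2 by rewrite hla.
elim: la sla nla => [|x la IH] //= pla; rewrite inE negb_or => /andP[x0 nla] x2.
have hd : head 0 la <= x by case: la pla {IH nla} => //= y la /andP[].
have {}IH := IH (path_sorted pla) nla (leq_trans hd x2).
case: (ltnP 1 x) => x1.
  have -> : x = 2 by lia.
  by rewrite /= {1}IH !add1n subSS.
have ex : x = 1 by lia.
have c0 : count (fun p => 1 < p) la = 0.
  apply/eqP; rewrite -leqn0 leqNgt -has_count; apply/hasPn => y yla.
  have : all (geq x) la by apply: order_path_min pla => a b c /=; lia.
  by move/allP=> /(_ _ yla); rewrite ex /=; lia.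
by rewrite ex add0n c0 /= add0n {1}IH c0 subn0.
Qed.

(** * Counting non-inversions *)

Definition noninv n (p : 'S_n) : {set 'I_n * 'I_n} :=
  [set ij : 'I_n * 'I_n | (ij.1 < ij.2) && (p ij.1 < p ij.2)].

(** The right-hand side depends on [n] only, so fewest inversions means most non-inversions. *)
Lemma inversions_noninv n (p : 'S_n) :
  inversions p + #|noninv p| = #|[set ij : 'I_n * 'I_n | ij.1 < ij.2]|.
Proof.
rewrite -(cardsID [set ij : 'I_n * 'I_n | p ij.2 < p ij.1]); congr (_ + _).
  by apply: eq_card => -[i j]; rewrite !inE.
apply: eq_card => -[i j]; rewrite !inE /= -leqNgt andbC.
case: (ltnP i j); rewrite ?andbF ?andbT //= => ij.
rewrite (leq_eqVlt (p i)); case: eqP => // /val_inj /perm_inj eij.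
by rewrite eij ltnn in ij.
Qed.

Lemma card_ord_ltn n c : c <= n -> #|[set i : 'I_n | i < c]| = c.
Proof.
move=> cn; have -> : [set i : 'I_n | i < c] = widen_ord cn @: [set: 'I_c].
  apply/setP => i; rewrite inE; apply/idP/imsetP => [ic|[j _ ->]] /=; last exact: ltn_ord.
  by exists (Ordinal ic); rewrite ?inE //; exact: val_inj.
by rewrite card_imset ?cardsT ?card_ord //; move=> i j /(congr1 val) /= /val_inj.
Qed.

Lemma layered_noninv n c (p : 'S_n) : c <= n -> layered c p ->
  c * (n - c) <= #|noninv p|.
Proof.
move=> cn hp; set A := [set i : 'I_n | i < c].
have cA : #|A| = c by exact: card_ord_ltn.
have <- : #|setX A (~: A)| = c * (n - c).
  by rewrite cardsX [#|~: A|]cardsCs setCK card_ord cA.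
apply/subset_leq_card/subsetP => -[i j]; rewrite !inE /= -leqNgt => /andP[ic cj].
rewrite !hp ic (ltnNge j c) cj /=; have := ltn_ord j; lia.
Qed.

Lemma card_split_ord n (X : {set 'I_n}) (i : 'I_n) : i \in X ->
  #|X| = (#|[set j in X | j < i]| + #|[set j in X | i < j]|).+1.
Proof.
move=> iX; rewrite (cardsD1 i) iX add1n; congr (_.+1).
rewrite -(cardsID [set j : 'I_n | j < i]); congr (_ + _); apply: eq_card => j.
  by rewrite !inE; case: eqP => [->|]; rewrite ?ltnn ?andbF.
by rewrite !inE -val_eqE /=; case: ltngtP; rewrite ?andbT ?andbF.
Qed.

(** A position is the number of positions before it, and a value the number of values below it. For
    [i] in [L] these count the points of [L] before [i] and after [i]; outside [L], those of the
    complement, plus [#|L|]. *)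
Lemma layered_of_blocks n (p : 'S_n) (L : {set 'I_n}) :
  dec_set p L -> dec_set p (~: L) ->
  (forall i j, i \in L -> j \notin L -> (i < j) && (p i < p j)) ->
  layered #|L| p.
Proof.
move=> dL dU LU i.
have card_lt m : m <= n -> #|[set j : 'I_n | j < m]| = m by exact: card_ord_ltn.
have iE : (i : nat) = #|[set j : 'I_n | j < i]| by rewrite card_lt // ltnW.
have piE : (p i : nat) = #|[set j | p j < p i]|.
  rewrite -[LHS](card_lt _ (ltnW (ltn_ord (p i)))) -[LHS](card_imset _ (@perm_inj _ (p^-1)%g)).
  congr #|pred_of_set _|; apply/setP => j; rewrite [RHS]inE; apply/imsetP/idP => [[k + ->]|pj].
    by rewrite inE permKV.
  by exists (p j); rewrite ?inE ?permK.
have dec X (a b : 'I_n) : dec_set p X -> a \in X -> b \in X -> (p a < p b) = (b < a).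
  move=> dX aX bX; case: (ltngtP b a) => [ba|ab|/val_inj ->]; last by rewrite ltnn.
    exact: dX.
  by have := dX _ _ aX bX ab; lia.
case: (boolP (i \in L)) => iL.
  have e1 : [set j : 'I_n | j < i] = [set j in L | j < i].
    apply/setP => j; rewrite !inE; case: (boolP (j \in L)) => //= jL.
    by have /andP[] := LU _ _ iL jL; lia.
  have e2 : [set j | p j < p i] = [set j in L | i < j].
    apply/setP => j; rewrite !inE; case: (boolP (j \in L)) => /= jL.
      exact: dec dL jL iL.
    by have /andP[] := LU _ _ iL jL; lia.
  have := card_split_ord iL; rewrite -e1 -e2 -iE -piE => ->.
  by rewrite ltnS leq_addr; lia.
have iU : i \in ~: L by rewrite inE.
have e1 : [set j : 'I_n | j < i] = L :|: [set j in ~: L | j < i].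
  apply/setP => j; rewrite !inE; case: (boolP (j \in L)) => //= jL.
  by have /andP[] := LU _ _ jL iL.
have e2 : [set j | p j < p i] = L :|: [set j in ~: L | i < j].
  apply/setP => j; rewrite !inE; case: (boolP (j \in L)) => /= jL.
    by have /andP[] := LU _ _ jL iL.
  by apply: dec dU _ iU; rewrite inE.
have cU (P : pred 'I_n) : #|L :|: [set j in ~: L | P j]| = #|L| + #|[set j in ~: L | P j]|.
  rewrite cardsU (_ : _ :&: _ = set0) ?cards0 ?subn0 //.
  by apply/setP => j; rewrite !inE; case: (j \in L).
have := card_split_ord iU; have := cardsC L; rewrite card_ord.
move: iE piE; rewrite e1 e2 !cU; case: ltnP; lia.
Qed.

(** * The graph of non-inversions *)

Section NoninversionGraph.

Variables (n : nat) (p : 'S_n).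

Definition asc (i j : 'I_n) : bool := (i < j) && (p i < p j).
Definition adj (i j : 'I_n) : bool := asc i j || asc j i.

Lemma adj_sym i j : adj i j = adj j i.
Proof. by rewrite /adj orbC. Qed.

(** Decreasing sets are the independent sets of the graph. *)
Lemma dec_setP (S : {set 'I_n}) :
  dec_set p S <-> (forall i j, i \in S -> j \in S -> ~~ asc i j).
Proof.
split=> dS i j iS jS; rewrite /asc.
  by apply/negP => /andP[ij]; have := dS _ _ iS jS ij; lia.
move=> ij; have := dS _ _ iS jS; rewrite /asc ij -leqNgt (leq_eqVlt (p j)) => /predU1P[|//].
by move=> /val_inj /perm_inj eij; rewrite eij ltnn in ij.
Qed.

(** An edge oriented against [asc x0 y0] would, by transitivity, give an edge inside [X] or inside
    [Y]. *)
Lemma asc_complete (X Y : {set 'I_n}) x0 y0 :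
  dec_set p X -> dec_set p Y ->
  {in X & Y, forall x y, adj x y} ->
  x0 \in X -> y0 \in Y -> asc x0 y0 -> {in X & Y, forall x y, asc x y}.
Proof.
move=> /dec_setP dX /dec_setP dY XY x0X y0Y a0.
have tr a b c : asc a b -> asc b c -> asc a c.
  by rewrite /asc => /andP[ab pab] /andP[bc pbc]; rewrite (ltn_trans ab) ?(ltn_trans pab).
have a0y y : y \in Y -> asc x0 y.
  move=> yY; case/orP: (XY _ _ x0X yY) => // yx.
  by have := dY _ _ yY y0Y; rewrite (tr _ _ _ yx a0).
move=> x y xX yY; case/orP: (XY _ _ xX yY) => // yx.
by have := dX _ _ x0X xX; rewrite (tr _ _ _ (a0y _ yY) yx).
Qed.

Hypothesis no_chain : forall i j k, asc i j -> ~~ asc j k.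

(** An edge between two neighbours of [i] would form a chain of length 3 with [i]. *)
Lemma dec_nbrs i : dec_set p [set j | adj i j].
Proof.
apply/dec_setP => j k; rewrite !inE /adj => /orP[ij|ji].
  by move=> _; exact: no_chain ij.
case/orP=> [ik|ki]; first by have := no_chain k ji; rewrite ik.
by apply/negP => jk; have := no_chain i jk; rewrite ki.
Qed.

Variable D : {set 'I_n}.
Hypothesis decD : dec_set p D.
Hypothesis maxD : forall S, dec_set p S -> #|S| <= #|D|.

(* Every non-inversion has an end in [~: D], and the neighbours of a point
   form a decreasing set since there is no chain of length 3: hence there are
   at most [#|D| * #|~: D|] of them. *)
Lemma adj_complete :
  #|D| * #|~: D| <= #|noninv p| ->
  dec_set p (~: D) /\ {in D & ~: D, forall x y, adj x y}.
Proof.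
move=> many.
pose S := [set xy : 'I_n * 'I_n | (xy.1 \notin D) && adj xy.1 xy.2].
(* A non-inversion is turned so that its first entry lies outside [D]. *)
pose f (ij : 'I_n * 'I_n) := if ij.1 \in D then (ij.2, ij.1) else ij.
have inj_f : {in noninv p &, injective f}.
  move=> [i j] [k l]; rewrite !inE /f /= => /andP[ij _] /andP[kl _].
  by case: ifP; case: ifP => _ _ [] ei ej; subst => //; move: ij kl; lia.
have fS : f @: noninv p \subset S.
  apply/subsetP => _ /imsetP[[i j] + ->]; rewrite !inE /f /= => ij.
  have aij : asc i j by [].
  case: ifP => iD /=; last by rewrite iD /adj aij.
  rewrite /adj aij orbT andbT; apply/negP => jD.
  by move/dec_setP: decD => /(_ _ _ iD jD); rewrite aij.
have cS : #|S| <= #|D| * #|~: D|.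
  have -> : #|S| = \sum_(x in ~: D) #|[set y | adj x y]|.
    rewrite -sum1_card (eq_bigl (fun xy => (xy.1 \in ~: D) && adj xy.1 xy.2)).
      rewrite -(pair_big_dep (mem (~: D)) adj (fun _ _ => 1)) /=.
      by apply: eq_bigr => x _; rewrite sum1dep_card.
    by move=> xy; rewrite !inE.
  rewrite mulnC -sum_nat_const; apply: leq_sum => x _; exact/maxD/dec_nbrs.
have eS : f @: noninv p = S.
  by apply/eqP; rewrite eqEcard fS card_in_imset // (leq_trans cS).
have dU : dec_set p (~: D).
  apply/dec_setP => i j; rewrite !inE => iD jD; apply/negP => ij.
  (* With both ends outside [D], the reversed pair is also in [S], yet [f] reverses only the
     non-inversions that start in [D]. *)
  have : (j, i) \in S by rewrite inE jD /= /adj ij orbT.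
  rewrite -eS => /imsetP[[k l]]; rewrite inE /f /= => /andP[kl _].
  case: ifP => kD [] ? ?; subst; first by rewrite kD in iD.
  by case/andP: ij; lia.
split=> // x y xD yD.
have SDD : S \subset setX (~: D) D.
  apply/subsetP => -[a b]; rewrite !inE /= => /andP[aD ab]; rewrite aD /=.
  apply/negPn/negP => bD; move/dec_setP: dU => dU.
  by case/orP: ab; apply/negP; apply: dU; rewrite inE.
have : (y, x) \in S; last by rewrite inE adj_sym => /andP[].
have -> : S = setX (~: D) D.
  apply/eqP; rewrite eqEcard SDD cardsX mulnC (leq_trans many) // -eS.
  by rewrite card_in_imset.
by rewrite inE /= yD xD.
Qed.

End NoninversionGraph.

Lemma minimal_layered n s r la (p : 'S_n) :
  part_of n la -> conj_part la = [:: s; r] -> r <= s -> 0 < r ->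
  minimal_perm la p ->
  exists2 c, layered c p & r <= c < n.
Proof.
move=> /andP[pla /eqP sla] conj rs r0 [shp minp].
have ela := two_column_shape pla conj.
have en : n = s + r.
  by rewrite -sla ela sumn_cat !sumn_nseq; lia.
have szla : size la = s by rewrite ela size_cat !size_nseq; lia.
have hla : head 0 la = 2 by rewrite ela; case: (r) r0.
clear sla; subst n.
have [q hq] := layered_exists (leq_addr r s).
have le_inv := minp q; rewrite (layered_shape rs hq) -ela in le_inv.
have many : s * r <= #|noninv p|.
  have := layered_noninv (leq_addr r s) hq; rewrite addKn => /leq_trans; apply.
  by have := inversions_noninv p; have := inversions_noninv q; have := le_inv erefl; lia.
have chain i j k : asc p i j -> ~~ asc p j k.
  case/andP=> ij pij; apply/negP => /andP[jk pjk].
  by have := @inc_triple_row _ p i j k; rewrite ij jk pij pjk shp hla; move=> /(_ isT isT).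
have [[D cD decD] maxD] := dec_set_rows p; rewrite shp szla in cD maxD.
have cU : #|~: D| = r by rewrite cardsCs setCK card_ord cD addKn.
have [] := adj_complete chain decD.
- by move=> S /maxD; rewrite cD.
- by rewrite cD cU.
move=> decU full.
have /card_gt0P[x0 x0D] : 0 < #|D| by rewrite cD; lia.
have /card_gt0P[y0 y0U] : 0 < #|~: D| by rewrite cU.
(* The orientation of a single edge decides whether [D] or its complement is the first block, that
   is, whether [c] is [s] or [r]. *)
case/orP: (full _ _ x0D y0U) => a0.
  exists s; last lia.
  suff: layered #|D| p by rewrite cD.
  apply: layered_of_blocks => // i j iD jD.
  by apply: (asc_complete decD decU full x0D y0U a0); rewrite ?inE.
exists r; last lia.
suff: layered #|~: D| p by rewrite cU.
apply: layered_of_blocks; rewrite ?setCK // => i j iU; rewrite inE negbK => jD.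
have full' : {in ~: D & D, forall x y, adj p x y}.
  by move=> x y xU yD; rewrite adj_sym full.
exact: (asc_complete decU decD full' y0U x0D a0).
Qed.

(** * Jumps *)

Lemma adj_trP n t :
  adj_tr n t = 1%g \/
  exists a b : 'I_n, [/\ adj_tr n t = tperm a b, a.+1 = b & (b : nat) = t].
Proof.
case: t => [|t] /=; first by left.
case: insubP => [a _ ea|]; last by left.
case: insubP => [b _ eb|]; last by left.
by right; exists a, b; rewrite ea eb.
Qed.

Lemma adj_tr_val n t (i : 'I_n) : 0 < t < n ->
  (adj_tr n t i : nat) = if i == t.-1 :> nat then t else if i == t :> nat then t.-1 else i.
Proof.
case: t => // t /andP[_ tn] /=.
rewrite (insubT (fun m => m < n) (ltnW tn)) (insubT (fun m => m < n) tn) /=.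
rewrite permE /= -!val_eqE /=.
by case: ifP => //; case: ifP.
Qed.

Lemma adj_trV n t : ((adj_tr n t)^-1)%g = adj_tr n t.
Proof. by case: (adj_trP n t) => [->|[a [b [-> _ _]]]]; rewrite ?invg1 ?tpermV. Qed.

Definition word_perm n (w : seq nat) : 'S_n := (\prod_(t <- w) adj_tr n t)%g.

Lemma word_perm_cons n t w : word_perm n (t :: w) = (adj_tr n t * word_perm n w)%g.
Proof. exact: big_cons. Qed.

Lemma foldl_swap_values n (p : 'S_n) w :
  foldl (@swap_values n) p w = (p * word_perm n w)%g.
Proof.
elim: w p => [|t w IH] p /=; first by rewrite /word_perm big_nil mulg1.
by rewrite IH word_perm_cons mulgA.
Qed.

(** Each new transposition is multiplied on the left, so the word appears reversed; as its letters
    are involutions, this is the inverse. *)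
Lemma foldl_swap_positions n (p : 'S_n) w :
  foldl (@swap_positions n) p w = ((word_perm n w)^-1 * p)%g.
Proof.
elim: w p => [|t w IH] p /=; first by rewrite /word_perm big_nil invg1 mul1g.
by rewrite IH word_perm_cons invMg adj_trV -mulgA.
Qed.

(** The only possible new inversion is the pair of positions carrying the two exchanged values. *)
Lemma inversions_adj_tr n (p : 'S_n) t :
  inversions (p * adj_tr n t) <= (inversions p).+1.
Proof.
case: (adj_trP n t) => [->|[a [b [-> ab _]]]]; first by rewrite mulg1.
rewrite -addn1 -(cards1 ((p^-1)%g a, (p^-1)%g b)).
apply: leq_trans (leq_card_setU _ _).
apply/subset_leq_card/subsetP => -[i j]; rewrite !inE xpair_eqE /= !permM => /andP[ij].
rewrite ij /= => lt_ji; rewrite !permE /= in lt_ji.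
suff: (p j < p i) || (p i == a) && (p j == b).
  by case/orP=> [->|/andP[/eqP <- /eqP <-]]; rewrite // !permK !eqxx orbT.
have : p i != p j by rewrite (inj_eq perm_inj) -val_eqE /=; lia.
move: lt_ji; rewrite -!val_eqE /=; do ? case: ifP; lia.
Qed.

Lemma inversions_word_perm n w : inversions (word_perm n w) <= size w.
Proof.
elim/last_ind: w => [|w t IH].
  rewrite /word_perm big_nil leqn0 cards_eq0; apply/eqP/setP => -[i j].
  by rewrite !inE /= !perm1; case: ltngtP.
rewrite /word_perm big_rcons /= size_rcons.
exact: leq_trans (inversions_adj_tr _ _) _.
Qed.

(** * Jump words as permutations *)

Definition cycle_up (a m x : nat) : nat :=
  if x == a then a + m else if a < x <= a + m then x.-1 else x.

(** Since [adj_tr n t] exchanges the ordinals [t - 1] and [t], the letters [a + 1, ..., a + m] carry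
    [a] up one step each. *)
Lemma word_perm_cycle n a m (i : 'I_n) : a + m < n ->
  (word_perm n [seq a + k | k <- iota 1 m] i : nat) = cycle_up a m i.
Proof.
rewrite /cycle_up; elim: m => [|m IH] amn.
  by rewrite /word_perm big_nil perm1 addn0; do ? case: ifP; lia.
rewrite -(addn1 m) iotaD map_cat /word_perm big_cat big_seq1 permM adj_tr_val; last lia.
rewrite IH; last lia.
do ? case: ifP; do ? case: ifP; lia.
Qed.

Lemma jump_word_cons c m mu :
  jump_word c (m :: mu) = [seq c.-1 + k | k <- iota 1 m] ++ jump_word c.-1 mu.
Proof.
rewrite /jump_word /= subn1; congr (_ ++ flatten _).
rewrite (iotaDl 1 1) -map_comp; apply/eq_in_map => j; rewrite mem_iota => j1 /=.
have -> : nth 0 (m :: mu) j = nth 0 mu j.-1 by case: j j1.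
by apply: eq_map => k; lia.
Qed.

Lemma size_jump_word c mu : size (jump_word c mu) = sumn mu.
Proof.
elim: mu c => [|m mu IH] c //.
by rewrite jump_word_cons size_cat IH size_map size_iota.
Qed.

(* With 0-based positions, the [j]-th factor of a jump word carries [c - j] to
   [c - j + mu_j] and shifts the positions in between down by one. *)
Fixpoint jump_fun (c : nat) (mu : seq nat) (x : nat) : nat :=
  if mu is m :: mu' then jump_fun c.-1 mu' (cycle_up c.-1 m x) else x.

Lemma head_part m mu : sorted geq (m :: mu) -> head 0 mu <= m.
Proof. by case: mu => //= k mu /andP[]. Qed.

Lemma word_perm_jump n c mu (i : 'I_n) :
  sorted geq mu -> size mu <= c -> c + head 0 mu <= n ->
  (word_perm n (jump_word c mu) i : nat) = jump_fun c mu i.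
Proof.
elim: mu c i => [|m mu IH] c i smu /= sz hd; first by rewrite /word_perm big_nil perm1.
have le := head_part smu.
rewrite jump_word_cons /word_perm big_cat permM IH ?(path_sorted smu) //; try lia.
by rewrite word_perm_cycle //; lia.
Qed.

Lemma jump_fun_fix c mu x :
  sorted geq mu -> size mu <= c -> c + head 0 mu <= x -> jump_fun c mu x = x.
Proof.
elim: mu c x => [|m mu IH] c x smu //= sz hd; have le := head_part smu.
have -> : cycle_up c.-1 m x = x by rewrite /cycle_up; do ? case: ifP; lia.
by rewrite IH ?(path_sorted smu) //; lia.
Qed.

(** Only the cycle starting at [x] moves it: earlier cycles act above [x], and later ones, being no
    longer and starting lower, end below its new place. *)
Lemma jump_fun_low c mu x :
  sorted geq mu -> size mu <= c -> x < c -> jump_fun c mu x = x + nth 0 mu (c.-1 - x).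
Proof.
elim: mu c x => [|m mu IH] c x smu /= sz xc; first by rewrite nth_nil addn0.
have le := head_part smu; case: (ltnP x c.-1) => xc1.
  have -> : cycle_up c.-1 m x = x by rewrite /cycle_up; do ? case: ifP; lia.
  rewrite IH ?(path_sorted smu) //; last lia.
  by have -> : c.-1 - x = (c.-2 - x).+1 by lia.
have -> : x = c.-1 by lia.
rewrite /cycle_up eqxx subnn jump_fun_fix ?(path_sorted smu) //; lia.
Qed.

(** The first cycle is increasing above its start [c.-1] and keeps the points there at or above
    [c.-1], as the remaining cycles require. *)
Lemma jump_fun_high c mu x y :
  size mu <= c -> c <= x -> x < y -> jump_fun c mu x < jump_fun c mu y.
Proof.
elim: mu c x y => [|m mu IH] c x y //= sz cx xy.
by apply: IH; rewrite /cycle_up; [lia | |]; do ? case: ifP; lia.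
Qed.

Lemma nth_part_geq mu i j : sorted geq mu -> i <= j -> nth 0 mu j <= nth 0 mu i.
Proof.
move=> smu ij; case: (ltnP j (size mu)) => jmu; last by rewrite nth_default.
apply: (sorted_leq_nth _ _ 0 smu i j) => //.
- by move=> y x z /=; lia.
- by move=> x /=.
- by rewrite inE (leq_ltn_trans ij).
Qed.

Lemma jump_fun_low_mono c mu x y :
  sorted geq mu -> size mu <= c -> x < y -> y < c -> jump_fun c mu x < jump_fun c mu y.
Proof.
move=> smu sz xy yc; rewrite !jump_fun_low //; last lia.
have : nth 0 mu (c.-1 - x) <= nth 0 mu (c.-1 - y) by apply: nth_part_geq => //; lia.
lia.
Qed.

Lemma part_eq_nth c mu nu :
  0 \notin mu -> 0 \notin nu -> size mu <= c -> size nu <= c ->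
  (forall i, i < c -> nth 0 mu i = nth 0 nu i) -> mu = nu.
Proof.
have le m v : 0 \notin v -> size m <= c -> size v <= c ->
    (forall i, i < c -> nth 0 m i = nth 0 v i) -> size v <= size m.
  move=> v0 szm szv e; rewrite leqNgt; apply/negP => lt.
  have := e (size m) (leq_trans lt szv); rewrite nth_default // => e0.
  by have := mem_nth 0 lt; rewrite -e0 (negPf v0).
move=> mu0 nu0 szm szn e.
have sz : size mu = size nu.
  by apply/eqP; rewrite eqn_leq !le // => i ic; rewrite e.
by apply: (eq_from_nth (x0 := 0)) => // i imu; apply: e; exact: leq_trans szm.
Qed.

(* [jump_fun c mu] is increasing on [0, c), hence determined there by its image. *)
Lemma jump_fun_image c mu nu :
  is_part mu -> is_part nu -> size mu <= c -> size nu <= c ->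
  (forall y, (exists2 x, x < c & y = jump_fun c mu x) <->
             (exists2 x, x < c & y = jump_fun c nu x)) ->
  mu = nu.
Proof.
move=> /andP[smu mu0] /andP[snu nu0] szm szn im.
have srt v : sorted geq v -> size v <= c -> sorted ltn (map (jump_fun c v) (iota 0 c)).
  move=> sv szv; rewrite sorted_map.
  have al : all (fun x => x < c) (iota 0 c) by apply/allP => x; rewrite mem_iota.
  apply: (sub_in_sorted _ al (iota_ltn_sorted 0 c)) => x y xc yc xy /=.
  exact: jump_fun_low_mono.
have eqm : map (jump_fun c mu) (iota 0 c) =i map (jump_fun c nu) (iota 0 c).
  have memE v y : y \in map (jump_fun c v) (iota 0 c) <-> exists2 x, x < c & y = jump_fun c v x.
    split=> [/mapP[x]|[x xc ->]]; first by rewrite mem_iota => xc ->; exists x.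
    by rewrite map_f // mem_iota.
  by move=> y; apply/idP/idP => /memE /im /memE.
have e := irr_sorted_eq ltn_trans ltnn (srt _ smu szm) (srt _ snu szn) eqm.
apply: (part_eq_nth (c := c)) => // i ic.
(* The position moved by the part of index [i] is [c.-1 - i]. *)
have /(_ (c.-1 - i)) := fun k => congr1 (fun s => nth 0 s k) e.
rewrite !(nth_map 0) ?size_iota ?nth_iota ?add0n; try lia.
rewrite !jump_fun_low //; try lia.
have -> : c.-1 - (c.-1 - i) = i by lia.
by lia.
Qed.

(** * Recovering the blocks from the jumped permutation *)

Lemma adj_dec_set n (p : 'S_n) (S : {set 'I_n}) x y :
  dec_set p S -> x \in S -> y \in S -> ~~ adj p x y.
Proof. by move=> /dec_setP dS xS yS; rewrite negb_or !dS. Qed.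

(* If [x] were in [A2] and not in [A1], every [y] in [A1] would be non-adjacent
   either to [x] or to [z]. *)
Lemma block_subset n (p : 'S_n) (A1 A2 : {set 'I_n}) (z : 'I_n) :
  dec_set p A2 -> dec_set p (~: A2) -> z \notin A1 -> z \notin A2 ->
  #|[set yx in setX A1 (~: A1) | ~~ adj p yx.1 yx.2]| < #|A1| -> A2 \subset A1.
Proof.
move=> dA dB z1 z2 few; apply/subsetP => x x2; apply: contraLR few => x1.
rewrite -leqNgt; pose f y := (y, if y \in A2 then x else z).
have inj_f : injective f by move=> y y' [].
rewrite -(card_imset _ inj_f); apply/subset_leq_card/subsetP => _ /imsetP[y y1 ->].
rewrite !inE /f /= y1; case: ifPn => y2.
  by rewrite x1 (adj_dec_set dA).
by rewrite z1 (adj_dec_set dB) ?inE.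
Qed.

Lemma layered_col1 n c (p : 'S_n) : 0 < c < n -> layered c p -> col1 p = c.
Proof.
move=> /andP[c0 cn] hp; pose i0 := Ordinal (ltn_trans c0 cn).
have sz : 0 < size (enum 'I_n) by rewrite size_enum_ord (ltn_trans c0).
rewrite /col1 -nth0 /one_line (nth_map i0) //.
have -> : nth i0 (enum 'I_n) 0 = i0 by apply: val_inj; rewrite /= nth_enum_ord // (ltn_trans c0).
by rewrite hp /= c0; lia.
Qed.

Section JumpBlocks.

Variables (n c : nat) (p : 'S_n) (mu nu : seq nat).
Hypothesis c_range : 0 < c < n.
Hypothesis p_layered : layered c p.
Hypothesis jump_p : is_jump p (mu, nu).

Let g := word_perm n (jump_word c mu).
Let h := word_perm n (jump_word c nu).
Let sigma := jump_act (mu, nu) p.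

(* The positions in [J(p)] of the entries of the first block of [p]. *)
Definition jump_block : {set 'I_n} :=
  word_perm n (jump_word c mu) @: [set i : 'I_n | i < c].

Lemma jump_bounds :
  [/\ is_part mu, is_part nu, size mu <= c, size nu <= c
    & (c + head 0 mu < n) && (c + head 0 nu < n)].
Proof.
move: jump_p; rewrite /is_jump /is_jump_component /col2 (layered_col1 c_range p_layered) /=.
by case/andP=> /and3P[-> -> +] /and3P[-> -> +]; split=> //; lia.
Qed.

Lemma jump_actE i : sigma (g i) = h (p i).
Proof.
rewrite /sigma /jump_act /outer_act /inner_act (layered_col1 c_range p_layered) /=.
by rewrite foldl_swap_values foldl_swap_positions !permM permK.
Qed.

Lemma inner_jump_fun i : (g i : nat) = jump_fun c mu i.
Proof.
by have [/andP[smu _] _ sz _ /andP[hd _]] := jump_bounds; rewrite word_perm_jump // ltnW.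
Qed.

Lemma outer_jump_fun i : (h i : nat) = jump_fun c nu i.
Proof.
by have [_ /andP[snu _] _ sz /andP[_ hd]] := jump_bounds; rewrite word_perm_jump // ltnW.
Qed.

Lemma layered_stable i : (p i < c) = (i < c).
Proof.
rewrite p_layered; have := ltn_ord i; case: (ltnP i c) => ic; lia.
Qed.

Lemma layered_decr (i j : 'I_n) : (i < c) = (j < c) -> i < j -> p j < p i.
Proof.
rewrite !p_layered; have := ltn_ord j.
by case: (ltnP i c) => ic; case: (ltnP j c) => jc //; lia.
Qed.

Lemma jump_fun_incr v (i j : 'I_n) : is_part v -> size v <= c ->
  (i < c) = (j < c) -> i < j -> jump_fun c v i < jump_fun c v j.
Proof.
move=> /andP[sv _] sz; case: (ltnP j c) => jc ic ij.
  exact: jump_fun_low_mono.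
by apply: jump_fun_high => //; rewrite leqNgt ic.
Qed.

Lemma inner_jump_incr (i j : 'I_n) : (i < c) = (j < c) -> (g i < g j) = (i < j).
Proof.
have [pmu _ sz _ _] := jump_bounds; rewrite !inner_jump_fun => ijc.
case: (ltngtP i j) => ij; last by rewrite ij ltnn.
  exact: jump_fun_incr.
by apply/negbTE; rewrite -leqNgt ltnW // jump_fun_incr.
Qed.

Lemma outer_jump_incr (i j : 'I_n) : (i < c) = (j < c) -> i < j -> h i < h j.
Proof. by have [_ pnu _ sz _] := jump_bounds; rewrite !outer_jump_fun; exact: jump_fun_incr. Qed.

Lemma mem_jump_block i : (g i \in jump_block) = (i < c).
Proof. by rewrite mem_imset ?inE //; exact: perm_inj. Qed.

Lemma card_jump_block : #|jump_block| = c.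
Proof. by rewrite card_imset ?card_ord_ltn //; [case/andP: c_range => _ /ltnW | exact: perm_inj]. Qed.

(** The strict bound on the first part of [mu] keeps every cycle of [g] below the last position. *)
Lemma last_notin_jump_block (z : 'I_n) : z.+1 = n -> z \notin jump_block.
Proof.
move=> ez; have [/andP[smu _] _ sz _ /andP[hd _]] := jump_bounds.
have gz : g z = z by apply: val_inj; rewrite /= inner_jump_fun jump_fun_fix //; lia.
by rewrite -gz mem_jump_block; lia.
Qed.

(** On each of [[0, c)] and [[c, n)], the maps [g] and [h] are increasing, while [p] is decreasing
    and preserves the interval. *)
Lemma dec_same_side (S : {set 'I_n}) :
  (forall i j, g i \in S -> g j \in S -> (i < c) = (j < c)) -> dec_set sigma S.
Proof.
move=> side x y; rewrite -(permKV g x) -(permKV g y).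
set i := (g^-1)%g x; set j := (g^-1)%g y => iS jS; have ijc := side _ _ iS jS.
rewrite (inner_jump_incr ijc) => ij; rewrite !jump_actE; apply: outer_jump_incr; rewrite ?layered_stable //.
exact: layered_decr.
Qed.

Lemma dec_jump_block : dec_set sigma jump_block.
Proof. by apply: dec_same_side => i j; rewrite !mem_jump_block => -> ->. Qed.

Lemma dec_jump_blockC : dec_set sigma (~: jump_block).
Proof.
by apply: dec_same_side => i j; rewrite !inE !mem_jump_block => /negbTE -> /negbTE ->.
Qed.

(** For [i < c <= j], the pair [(i, j)] is a non-inversion of [p]. It ceases to be an edge only if
    [g] inverts the positions or [h] inverts the values [p i], [p j], and the lengths of the jump
    words bound these inversions. *)
Lemma card_nonadj_jump_block :
  #|[set yx in setX jump_block (~: jump_block) | ~~ adj sigma yx.1 yx.2]|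
    <= jump_size (mu, nu).
Proof.
pose F (ij : 'I_n * 'I_n) := (g ij.1, g ij.2).
pose G (ij : 'I_n * 'I_n) := F ((p^-1)%g ij.1, (p^-1)%g ij.2).
pose inv (q : 'S_n) := [set ij : 'I_n * 'I_n | (ij.1 < ij.2) && (q ij.2 < q ij.1)].
have le_inv v : #|inv (word_perm n (jump_word c v))| <= sumn v.
  by rewrite -(size_jump_word c v); exact: inversions_word_perm.
apply: (@leq_trans #|F @: inv g :|: G @: inv h|); last first.
  apply: leq_trans (leq_card_setU _ _) _; apply: leq_add.
    exact: leq_trans (leq_imset_card _ _) (le_inv mu).
  exact: leq_trans (leq_imset_card _ _) (le_inv nu).
apply/subset_leq_card/subsetP => -[x y].
rewrite -(permKV g x) -(permKV g y); set i := (g^-1)%g x; set j := (g^-1)%g y.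
rewrite !inE /= !mem_jump_block -leqNgt => /andP[/andP[ic cj]].
have ij : i < j by lia.
rewrite /adj /asc !jump_actE negb_or => /andP[a1 a2].
case: (ltngtP (g i) (g j)) a1 => [gij|gji|/val_inj /perm_inj eij].
- rewrite -leqNgt leq_eqVlt => /predU1P[/val_inj /perm_inj /perm_inj eij|hji].
    by rewrite eij ltnn in ij.
  apply/orP; right; apply/imsetP; exists (p i, p j); last by rewrite /G /= !permK.
  rewrite inE /= hji andbT; have := layered_stable i; have := layered_stable j; lia.
- by move=> _; apply/orP; left; apply/imsetP; exists (i, j); rewrite ?inE /= ?ij.
- by rewrite eij ltnn in ij.
Qed.

End JumpBlocks.

(** Both blocks live in the same permutation, so [block_subset] applies in either direction, with
    [z] the last position. *)
Lemma jump_act_block_eq n c1 c2 (p1 p2 : 'S_n) (J1 J2 : seq nat * seq nat) :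
  0 < c1 < n -> 0 < c2 < n -> layered c1 p1 -> layered c2 p2 ->
  is_jump p1 J1 -> is_jump p2 J2 -> jump_size J1 < c1 -> jump_size J2 < c2 ->
  jump_act J1 p1 = jump_act J2 p2 ->
  jump_block n c1 J1.1 = jump_block n c2 J2.1.
Proof.
case: J1 J2 => [mu1 nu1] [mu2 nu2] /= r1 r2 l1 l2 j1 j2 s1 s2 e.
have n0 : n.-1 < n by lia.
have zE : (Ordinal n0).+1 = n by rewrite /=; lia.
have z1 := last_notin_jump_block r1 l1 j1 zE.
have z2 := last_notin_jump_block r2 l2 j2 zE.
apply/eqP; rewrite eqEsubset; apply/andP; split.
  apply: block_subset (dec_jump_block r1 l1 j1) (dec_jump_blockC r1 l1 j1) z2 z1 _.
  by rewrite (card_jump_block _ r2) e (leq_ltn_trans (card_nonadj_jump_block r2 l2 j2)).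
apply: block_subset (dec_jump_block r2 l2 j2) (dec_jump_blockC r2 l2 j2) z1 z2 _.
by rewrite (card_jump_block _ r1) -e (leq_ltn_trans (card_nonadj_jump_block r1 l1 j1)).
Qed.

Lemma jump_act_inj n c (p : 'S_n) (J1 J2 : seq nat * seq nat) :
  0 < c < n -> layered c p -> is_jump p J1 -> is_jump p J2 ->
  jump_size J1 < c -> jump_size J2 < c -> jump_act J1 p = jump_act J2 p -> J1 = J2.
Proof.
move=> rg lp j1 j2 s1 s2 e.
have := jump_act_block_eq rg rg lp lp j1 j2 s1 s2 e.
case: J1 J2 j1 j2 {s1 s2} e => [mu1 nu1] [mu2 nu2] /= j1 j2 e eA.
have [pmu1 pnu1 sm1 sn1 _] := jump_bounds rg lp j1.
have [pmu2 pnu2 sm2 sn2 _] := jump_bounds rg lp j2.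
have [_ cn] := andP rg.
(* The block is the image of [[0, c)] under [jump_fun c mu], which [jump_fun_image] can use. *)
have memA mu nu : is_jump p (mu, nu) ->
    forall y, (exists2 x, x < c & y = jump_fun c mu x) <->
              (exists2 z : 'I_n, z \in jump_block n c mu & y = z).
  move=> j y; split=> [[x xc ->]|[z /imsetP[i]]].
    have xn := ltn_trans xc cn; exists (word_perm n (jump_word c mu) (Ordinal xn)).
      by apply: imset_f; rewrite inE.
    by rewrite (inner_jump_fun rg lp j).
  by rewrite inE => ic -> ->; exists i; rewrite ?(inner_jump_fun rg lp j).
have emu : mu1 = mu2.
  apply: (jump_fun_image (c := c)) => // y.
  by rewrite (memA _ _ j1) eA -(memA _ _ j2).
subst mu2; congr (_, _).
(* With equal inner parts, both jumps send position [i] to the same place, so the values found there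
   agree. *)
have eh (i : 'I_n) : jump_fun c nu1 (p i) = jump_fun c nu2 (p i).
  by rewrite -(outer_jump_fun rg lp j1) -(outer_jump_fun rg lp j2) -(jump_actE mu1 nu1 rg lp) -(jump_actE mu1 nu2 rg lp) e.
have eh' x : x < c -> jump_fun c nu1 x = jump_fun c nu2 x.
  by move=> xc; have := eh ((p^-1)%g (Ordinal (ltn_trans xc cn))); rewrite permKV.
apply: (jump_fun_image (c := c)) => // y.
by split=> -[x xc ->]; exists x; rewrite ?eh'.
Qed.

Theorem theorem21 (n s r : nat) (la : seq nat)
    (hla : part_of n la) (hconj : conj_part la = [:: s; r])
    (hsr : r <= s) (hr : 1 <= r) :
  (forall (p : 'S_n) (J1 J2 : seq nat * seq nat),
     minimal_perm la p ->
     is_jump p J1 -> is_jump p J2 -> J1 <> J2 ->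
     jump_size J1 < r -> jump_size J2 < r ->
     valid_jump p J1 -> valid_jump p J2 ->
     jump_act J1 p <> jump_act J2 p)
  /\
  (forall (p1 p2 : 'S_n) (J1 J2 : seq nat * seq nat),
     minimal_perm la p1 -> minimal_perm la p2 -> p1 <> p2 ->
     is_jump p1 J1 -> is_jump p2 J2 ->
     jump_size J1 < r -> jump_size J2 < r ->
     valid_jump p1 J1 -> valid_jump p2 J2 ->
     jump_act J1 p1 <> jump_act J2 p2).
Proof.
split=> [p J1 J2 minp j1 j2 neJ s1 s2 _ _ e
        | p1 p2 J1 J2 min1 min2 nep j1 j2 s1 s2 _ _ e].
  have [c lc /andP[rc cn]] := minimal_layered hla hconj hsr hr minp.
  by apply: neJ; apply: (jump_act_inj (c := c)) e => //; lia.
have [c1 lc1 /andP[rc1 cn1]] := minimal_layered hla hconj hsr hr min1.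
have [c2 lc2 /andP[rc2 cn2]] := minimal_layered hla hconj hsr hr min2.
have rg1 : 0 < c1 < n by lia.
have rg2 : 0 < c2 < n by lia.
have eA := jump_act_block_eq rg1 rg2 lc1 lc2 j1 j2 (leq_trans s1 rc1) (leq_trans s2 rc2) e.
(* The cardinality of a block recovers its parameter. *)
have ec : c1 = c2.
  by rewrite -(card_jump_block J1.1 rg1) eA (card_jump_block J2.1 rg2).
by apply: nep; apply: layered_inj lc1 _; rewrite ec.
Qed.
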